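(* (i) Let $h:\mathbb{R}^d\to[-\infty,\infty)$ be a measurable function that is not identically $-\infty$, and define the exponentially concave function $\varphi$ on $\Omega_0$ by $$\varphi(\mu)=\inf_{\theta\in\mathbb{R}^d}\left[\log \mu\left(e^{-\langle\theta,x\rangle}\right)-h(\theta)\right],\qquad \mu\in\Omega_0 .$$ Then the function $\psi:\mathbb{R}^d\to\mathbb{R}\cup\{-\infty\}$ defined by $$\psi(\alpha)=\varphi(\mu_\alpha)+\Lambda_0(\alpha),\qquad \alpha\in\mathbb{R}^d,$$ is $\Lambda_0$-concave on $\mathbb{R}^d$. (ii) Conversely, let $\psi$ be a $\Lambda_0$-concave function on $\mathbb{R}^d$, let $\psi^0$ be its $\Lambda_0$-conjugate, and define the exponentially concave function $\varphi$ on $\Omega_0$ by $$\varphi(\mu)=\inf_{\theta\in\mathbb{R}^d}\left[\log \mu\left(e^{-\langle\theta,x\rangle}\right)-\psi^0(\theta)\right],\qquad \mu\in\Omega_0 .$$ Then $\varphi(\mu_\alpha)=\psi(\alpha)-\Lambda_0(\alpha)$ for all $\alpha\in\mathbb{R}^d$.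
   Context: Fix $d\in\mathbb{N}$ and a Borel probability measure $\mu_0$ on $\mathbb{R}^d$ (the base measure). For a measure $\mu$ and a function $f$, $\mu(f)$ or $\mu(f(x))$ denotes the integral $\int f\,d\mu$. Let $\Lambda_0(\theta)=\log\mu_0(e^{\langle\theta,x\rangle})$, $\theta\in\mathbb{R}^d$, be the cumulant generating function of $\mu_0$; it is assumed that $\Lambda_0(\theta)<\infty$ for all $\theta\in\mathbb{R}^d$. $\Omega_0$ is the convex set of Borel probability measures on $\mathbb{R}^d$ that are absolutely continuous with respect to $\mu_0$. For $\alpha\in\mathbb{R}^d$, $\mu_\alpha\in\Omega_0$ is the probability measure with $$\frac{d\mu_\alpha}{d\mu_0}(x)=\exp\left(\langle\alpha,x\rangle-\Lambda_0(\alpha)\right).$$ A function $\varphi$ on a convex set of probability measures is exponentially concave if $\exp(\varphi)$ is a nonnegative concave function on that set. Here $\mu(e^{-\langle\theta,x\rangle})\in(0,\infty]$ may be infinite, so functions on $\Omega_0$ defined by the infima above are allowed to take values in $[-\infty,+\infty]$, with the convention $(+\infty)-(+\infty)=-\infty$ (needed only when $\psi\equiv-\infty$). A function $\psi:\mathbb{R}^d\to\mathbb{R}\cup\{-\infty\}$ is $\Lambda_0$-concave if $\psi(x)=\inf_{y\in\mathbb{R}^d}[\Lambda_0(x-y)-\rho(y)]$ for all $x\in\mathbb{R}^d$, for some $\rho:\mathbb{R}^d\to\mathbb{R}\cup\{-\infty\}$. The $\Lambda_0$-conjugate of $\psi$ is $$\psi^0(y)=\inf_{x\in\mathbb{R}^d}\left[\Lambda_0(x-y)-\psi(x)\right],\qquad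 y\in\mathbb{R}^d$$ (which equals $+\infty$ identically only in the degenerate case $\psi\equiv-\infty$). *)

(* Defs.v *)
From HB Require Import structures.
From mathcomp Require Import all_boot all_order all_algebra.
From mathcomp Require Import all_classical all_reals all_analysis.
From mathcomp Require Import measurable_realfun.

Set Implicit Arguments.
Unset Strict Implicit.
Unset Printing Implicit Defensive.

Import Order.TTheory GRing.Theory Num.Def Num.Theory.
Import numFieldNormedType.Exports.

Local Open Scope classical_set_scope.
Local Open Scope ring_scope.
Local Open Scope ereal_scope.

(* R^d with its Borel sigma-algebra.  The carrier is convertible to 'rV[R]_d;
   the alias only selects the measurable structure. *)
Definition Rd (R : realType) (d : nat) :=
  g_sigma_algebraType (@open 'rV[R]_d).

Definition dot (R : realType) (d : nat) (x y : 'rV[R]_d) : R :=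
  (\sum_(i < d) x ord0 i * y ord0 i)%R.

Section mixture.
Context {disp : measure_display} {T : measurableType disp} {R : realType}.
Variables (t : {i01 R}) (mu nu : probability T R).

Definition mixture : set T -> \bar R :=
  measure_add (mscale ((t%:num)%:nng)%R mu) (mscale ((1 - t%:num)%:nng)%R nu).

HB.instance Definition _ := Measure.on mixture.

Lemma mixtureE A :
  mixture A = (t%:num)%:E * mu A + (1 - t%:num)%:E * nu A.
Proof. by rewrite [LHS]measure_addE. Qed.

Let mixture_setT : mixture [set: T] = 1.
Proof.
by rewrite mixtureE !probability_setT !mule1 -EFinD addrC subrK.
Qed.

HB.instance Definition _ :=
  @Measure_isProbability.Build _ _ R mixture mixture_setT.

End mixture.

(* The nonnegativity of exp(phi) holds automatically since expeR has values in
   [0, +oo].  The infinite values of phi are handled by expeR -oo = 0,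
   expeR +oo = +oo and 0 * +oo = 0. *)
Definition exponentially_concave {disp : measure_display}
    {T : measurableType disp} {R : realType}
    (C : set (probability T R)) (phi : probability T R -> \bar R) : Prop :=
  forall (t : {i01 R}) (mu nu : probability T R), C mu -> C nu ->
    (t%:num)%:E * expeR (phi mu) + (1 - t%:num)%:E * expeR (phi nu)
      <= expeR (phi (mixture t mu nu)).

Section base_measure.
Context {R : realType} {d : nat}.
Variable mu0 : probability (Rd R d) R.

Definition cgf (theta : 'rV[R]_d) : \bar R :=
  lne (\int[mu0]_x (expR (dot theta x))%:E).

Definition Omega0 : set (probability (Rd R d) R) :=
  [set mu | mu `<< mu0].

Definition tilt (alpha : 'rV[R]_d) (A : set (Rd R d)) : \bar R :=
  \int[mu0]_(x in A) expeR ((dot alpha x)%:E - cgf alpha).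

Lemma measurable_dot (alpha : 'rV[R]_d) :
  measurable_fun [set: Rd R d] (dot alpha).
Proof.
apply: measurable_sum => i; apply: measurable_funM => //.
apply: (measurability _ (RGenOpens.measurableE R)).
move=> _ [_ [a [b ->]] <-]; rewrite setTI.
apply: sub_sigma_algebra.
have /continuousP := @coord_continuous R 1 d ord0 i; apply.
exact: interval_open.
Qed.

Lemma Omega0_convex (t : {i01 R}) (mu nu : probability (Rd R d) R) :
  Omega0 mu -> Omega0 nu -> Omega0 (mixture t mu nu).
Proof.
move=> /null_content_dominatesP hmu /null_content_dominatesP hnu.
apply/null_content_dominatesP => A mA A0.
by rewrite [LHS]mixtureE hmu// hnu// !mule0 adde0.
Qed.

Lemma measurable_density (alpha : 'rV[R]_d) :
  measurable_fun [set: Rd R d]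
    (fun x : Rd R d => expeR ((dot alpha x)%:E - cgf alpha)).
Proof.
under eq_fun do rewrite expeRD /=.
apply: emeasurable_funM => //; apply/measurable_EFinP.
by apply: measurableT_comp => //; exact: measurable_dot.
Qed.

Let tilt0 alpha : tilt alpha set0 = 0.
Proof. exact: integral_set0. Qed.

Let tilt_ge0 alpha A : 0 <= tilt alpha A.
Proof. by apply: integral_ge0 => x _; exact: expeR_ge0. Qed.

Let tilt_sigma_additive alpha : semi_sigma_additive (tilt alpha).
Proof.
move=> A mA tA mUA; rewrite /tilt ge0_integral_bigcup//.
- by apply: is_cvg_ereal_nneg_natsum_cond => n _ _; exact: tilt_ge0.
- by apply: measurable_funTS; exact: measurable_density.
- by move=> x _; exact: expeR_ge0.
Qed.

HB.instance Definition _ alpha := isMeasure.Build _ _ _ (tilt alpha)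
  (tilt0 alpha) (tilt_ge0 alpha) (@tilt_sigma_additive alpha).

Lemma mgf_gt0 theta : 0 < \int[mu0]_x (expR (dot theta x))%:E.
Proof.
have mf : measurable_fun [set: Rd R d] (fun x => (expR (dot theta x))%:E).
  by apply/measurable_EFinP/measurableT_comp => //; exact: measurable_dot.
rewrite lt_neqAle integral_ge0 ?andbT; last first.
  by move=> x _; rewrite lee_fin expR_ge0.
apply/eqP => /esym I0.
have : ae_eq mu0 [set: Rd R d] (fun x => (expR (dot theta x))%:E) (cst 0).
  apply/ae_eq_integral_abs => //; rewrite -[RHS]I0.
  by apply: eq_integral => x _; rewrite gee0_abs// lee_fin expR_ge0.
move=> [N [mN N0 sN]].
have : mu0 [set: Rd R d] = 0.
  rewrite -(setTU N) -N0; congr (mu0 _).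
  apply/seteqP; split => // x _; apply: sN => /= /(_ Logic.I) /eqP.
  by rewrite eqe gt_eqF// expR_gt0.
by rewrite probability_setT => /eqP; rewrite onee_eq0.
Qed.

(* tilt alpha, with the finiteness of cgf recorded as a parameter so that the
   probability instance can be inferred. *)
Definition tilted of (forall theta, cgf theta < +oo) :=
  fun alpha : 'rV[R]_d => tilt alpha.

Section tilted.
Hypothesis cgf_fin : forall theta, cgf theta < +oo.
Variable alpha : 'rV[R]_d.

Let tilt_setT : tilt alpha [set: Rd R d] = 1.
Proof.
have mf : measurable_fun [set: Rd R d] (fun x => (expR (dot alpha x))%:E).
  by apply/measurable_EFinP/measurableT_comp => //; exact: measurable_dot.
rewrite /tilt; under eq_integral do rewrite expeRD /=.
rewrite ge0_integralZr ?expeR_ge0//.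
have := mgf_gt0 alpha; have := cgf_fin alpha; rewrite /cgf.
case: (integral _ _ _) => [r _ r0| |] //.
rewrite lne_EFin//= expRN lnK// -EFinM divff// gt_eqF//.
Qed.

HB.instance Definition _ := Measure.on (tilted cgf_fin alpha).

HB.instance Definition _ := @Measure_isProbability.Build _ _ R
  (tilted cgf_fin alpha) tilt_setT.

Lemma tiltedE A :
  tilted cgf_fin alpha A =
  \int[mu0]_(x in A) expeR ((dot alpha x)%:E - cgf alpha).
Proof. by []. Qed.

Lemma tilted_Omega0 : Omega0 (tilted cgf_fin alpha).
Proof.
apply/null_content_dominatesP => A mA A0; rewrite [LHS]tiltedE.
apply: null_set_integral => //.
by apply: measurable_funTS; exact: measurable_density.
Qed.

End tilted.

End base_measure.

(* In ereal_scope, +oo - +oo = -oo. *)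
Definition variational {R : realType} {d : nat} (h : 'rV[R]_d -> \bar R)
    (mu : probability (Rd R d) R) : \bar R :=
  ereal_inf [set lne (\int[mu]_x (expR (- dot theta x))%:E) - h theta
            | theta in [set: 'rV[R]_d]].

(* The next two definitions are meant for a finite-valued L and for psi with
   values in R \cup {-oo}. *)
Definition conjugate {R : realType} {d : nat} (L psi : 'rV[R]_d -> \bar R)
    (y : 'rV[R]_d) : \bar R :=
  ereal_inf [set L (x - y)%R - psi x | x in [set: 'rV[R]_d]].

Definition L_concave {R : realType} {d : nat} (L psi : 'rV[R]_d -> \bar R) :
    Prop :=
  (forall x, psi x < +oo) /\
  exists2 rho : 'rV[R]_d -> \bar R, (forall y, rho y < +oo) &
    forall x, psi x = ereal_inf [set L (x - y)%R - rho y
                                | y in [set: 'rV[R]_d]].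

(* Main.v *)
(**
  Under [mu_alpha] the log-integral of [exp (- <theta, x>)] equals
  [Lambda_0 (alpha - theta) - Lambda_0 alpha], so [phi mu_alpha + Lambda_0 alpha]
  is the [Lambda_0]-conjugate of [h] at [alpha].  This gives (i) with [rho = h],
  and (ii) because a [Lambda_0]-concave function is its own biconjugate.
  For exponential concavity, [exp phi] is an infimum of functions that are
  affine in [mu] (or identically [0] or [+oo], when [h theta] is infinite).
*)
Require Import Defs.
From HB Require Import structures.
From mathcomp Require Import all_boot all_order all_algebra.
From mathcomp Require Import all_classical all_reals all_analysis.
From mathcomp Require Import measurable_realfun.

Set Implicit Arguments.
Unset Strict Implicit.
Unset Printing Implicit Defensive.

Import Order.TTheory GRing.Theory Num.Def Num.Theory.
Import numFieldNormedType.Exports.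

Local Open Scope classical_set_scope.
Local Open Scope ring_scope.
Local Open Scope ereal_scope.

(** Any density [g] agrees [mu]-almost everywhere with the Radon-Nikodym derivative, for which
    change of variables is known. *)
Lemma ge0_integral_density {disp : measure_display} {T : measurableType disp}
    {R : realType} (nu : {finite_measure set T -> \bar R})
    (mu : {sigma_finite_measure set T -> \bar R}) (g f : T -> \bar R) :
  measurable_fun [set: T] g -> (forall x, 0 <= g x) ->
  (forall A, measurable A -> nu A = \int[mu]_(x in A) g x) ->
  measurable_fun [set: T] f -> (forall x, 0 <= f x) ->
  \int[nu]_x f x = \int[mu]_x (f x * g x).
Proof.
move=> mg g0 nuE mf f0.
have numu : nu `<< mu.
  apply/null_content_dominatesP => A mA A0; rewrite nuE//.
  by apply: null_set_integral => //; exact: measurable_funTS.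
rewrite -(Radon_Nikodym_SigmaFinite.change_of_variables numu f0)//.
(* Finiteness of [nu] makes the derivative integrable, so equality of integrals over all measurable
   sets forces almost everywhere equality. *)
have ifr := Radon_Nikodym_SigmaFinite.f_integrable numu.
have [N [mN N0 sN]] : ae_eq mu [set: T] (Radon_Nikodym_SigmaFinite.f nu mu) g.
  apply: integral_ae_eq => // A _ mA.
  by rewrite -nuE// -Radon_Nikodym_SigmaFinite.f_integral.
apply: ge0_ae_eq_integral => //.
- by apply: emeasurable_funM => //; exact: measurable_int ifr.
- exact: emeasurable_funM.
- by move=> x _; rewrite mule_ge0//; exact: Radon_Nikodym_SigmaFinite.f_ge0.
- by move=> x _; rewrite mule_ge0.
exists N; split => // x /= nx; apply: sN => /= gx; apply: nx => _.
by rewrite gx.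
Qed.

Lemma dotNl {R : realType} {d : nat} (x y : 'rV[R]_d) :
  dot (- x)%R y = (- dot x y)%R.
Proof.
by rewrite /dot -sumrN; apply: eq_bigr => i _; rewrite mxE mulNr.
Qed.

Lemma dotDl {R : realType} {d : nat} (x y z : 'rV[R]_d) :
  dot (x + y)%R z = (dot x z + dot y z)%R.
Proof.
by rewrite /dot -big_split; apply: eq_bigr => i _ /=; rewrite mxE mulrDl.
Qed.

Lemma measurable_expR_dot {R : realType} {d : nat} (theta : 'rV[R]_d) :
  measurable_fun [set: Rd R d] (fun x : Rd R d => (expR (dot theta x))%:E).
Proof.
by apply/measurable_EFinP/measurableT_comp => //; exact: measurable_dot.
Qed.

(** Taking [mu] itself as base measure makes the facts about [cgf] available for every term of the
    infimum. *)
Lemma variationalE {R : realType} {d : nat} (h : 'rV[R]_d -> \bar R)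
    (mu : probability (Rd R d) R) :
  variational h mu =
  ereal_inf [set cgf mu (- theta)%R - h theta | theta in [set: 'rV[R]_d]].
Proof.
congr ereal_inf; apply: eq_imagel => theta _; congr (lne _ - _).
by apply: eq_integral => x _; rewrite dotNl.
Qed.

Lemma expeR_cgf {R : realType} {d : nat} (mu : probability (Rd R d) R)
    (theta : 'rV[R]_d) :
  expeR (cgf mu theta) = \int[mu]_x (expR (dot theta x))%:E.
Proof. by rewrite lneK// in_itv/= leey ltW// mgf_gt0. Qed.

Lemma cgf_gtNy {R : realType} {d : nat} (mu : probability (Rd R d) R)
    (theta : 'rV[R]_d) : -oo < cgf mu theta.
Proof.
rewrite ltNye -expeR_eq0 expeR_cgf gt_eqF//; exact: mgf_gt0.
Qed.

Lemma cgf_tilted {R : realType} {d : nat} (mu0 : probability (Rd R d) R)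
    (cgf_fin : forall theta : 'rV[R]_d, cgf mu0 theta < +oo)
    (alpha theta : 'rV[R]_d) :
  cgf (tilted cgf_fin alpha) theta = cgf mu0 (alpha + theta)%R - cgf mu0 alpha.
Proof.
have fin x : cgf mu0 x \is a fin_num.
  by rewrite fin_numElt cgf_gtNy cgf_fin.
(* Exponentiating reduces the claim to moment generating functions, where the normalising factor of
   the density comes out of the integral. *)
rewrite -[RHS]expeRK expeRD expeR_cgf /cgf; congr lne.
rewrite (@ge0_integral_density _ _ _ _ mu0
  (fun x : Rd R d => expeR ((dot alpha x)%:E - cgf mu0 alpha)))//.
- under eq_integral do rewrite expeRD muleA -EFinM -expRD addrC -dotDl.
  by rewrite ge0_integralZr ?expeR_ge0//; exact: measurable_expR_dot.
- exact: measurable_density.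
- by move=> x; exact: expeR_ge0.
- exact: measurable_expR_dot.
Qed.

Lemma ge0_integral_mixture {disp : measure_display} {T : measurableType disp}
    {R : realType} (t : {i01 R}) (mu nu : probability T R) (f : T -> \bar R) :
  measurable_fun [set: T] f -> (forall x, 0 <= f x) ->
  \int[mixture t mu nu]_x f x =
  (t%:num)%:E * \int[mu]_x f x + (1 - t%:num)%:E * \int[nu]_x f x.
Proof.
by move=> mf f0; rewrite ge0_integral_measure_add// !ge0_integral_mscale.
Qed.

Lemma variational_exponentially_concave {R : realType} {d : nat}
    (C : set (probability (Rd R d) R)) (h : 'rV[R]_d -> \bar R) :
  exponentially_concave C (variational h).
Proof.
move=> t mu nu _ _; have t0 : 0 <= (t%:num)%:E :> \bar R by rewrite lee_fin.
have t1 : 0 <= (1 - t%:num)%:E :> \bar R by rewrite lee_fin.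
set S := (X in X <= _).
have S0 : 0 <= S by rewrite adde_ge0// mule_ge0// expeR_ge0.
(* On the logarithmic scale the bound can be checked against each term of the infimum separately. *)
suff: lne S <= variational h (mixture t mu nu).
  by rewrite -lee_expeR lneK// in_itv/= leey S0.
rewrite variationalE; apply: le_ereal_inf_tmp => _ [theta _ <-].
have le (m : probability (Rd R d) R) :
    expeR (variational h m) <= expeR (cgf m (- theta)%R - h theta).
  by rewrite lee_expeR variationalE; apply: ereal_inf_lbound; exists theta.
rewrite -lee_expeR lneK ?in_itv/= ?leey ?S0//.
apply: (@le_trans _ _ ((t%:num)%:E * expeR (cgf mu (- theta)%R - h theta) +
    (1 - t%:num)%:E * expeR (cgf nu (- theta)%R - h theta))).
  by apply: leeD; apply: lee_wpmul2l.
(* For fixed [theta] both sides are equal, since the integral is affine in the measure. Infinite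
   values are harmless: [+oo - +oo = -oo] matches [+oo * 0 = 0], and nonnegativity lets the factor
   [expeR (- h theta)] distribute even when it is [+oo]. *)
rewrite !expeRD !expeR_cgf ge0_integral_mixture//; last first.
  exact: measurable_expR_dot.
by rewrite !muleA ge0_muleDl// mule_ge0// ltW// mgf_gt0.
Qed.

Lemma ereal_inf_addl {R : realType} {I : Type} (a : \bar R) (f : I -> \bar R)
    (A : set I) : a \is a fin_num ->
  ereal_inf [set a + f i | i in A] = a + ereal_inf [set f i | i in A].
Proof.
move=> afin; apply/eqP; rewrite eq_le; apply/andP; split.
  rewrite -leeBlDl//; apply: le_ereal_inf_tmp => _ [i Ai <-].
  by rewrite leeBlDl//; apply: ereal_inf_lbound; exists i.
apply: le_ereal_inf_tmp => _ [i Ai <-]; rewrite leeD2l//.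
by apply: ereal_inf_lbound; exists i.
Qed.

Lemma variational_tilted {R : realType} {d : nat}
    (mu0 : probability (Rd R d) R)
    (cgf_fin : forall theta : 'rV[R]_d, cgf mu0 theta < +oo)
    (h : 'rV[R]_d -> \bar R) (alpha : 'rV[R]_d) :
  variational h (tilted cgf_fin alpha) =
  ereal_inf [set cgf mu0 (alpha - theta)%R - h theta
            | theta in [set: 'rV[R]_d]] - cgf mu0 alpha.
Proof.
have fin : - cgf mu0 alpha \is a fin_num.
  by rewrite fin_numN fin_numElt cgf_gtNy cgf_fin.
rewrite variationalE [RHS]addeC -ereal_inf_addl//.
congr ereal_inf; apply: eq_imagel => theta _.
by rewrite cgf_tilted addeA [in RHS](addeC (- _)).
Qed.

(** This symmetry between [x] and [z] is the Galois connection underlying conjugation. *)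
Lemma leeB_swap {R : realType} (x y z : \bar R) :
  z != +oo -> y \is a fin_num -> x <= y - z -> z <= y - x.
Proof.
by move: x y z => [x| |] [y| |] [z| |]//= _ _; rewrite ?leey ?leNye// -?EFinB
  ?lee_fin => h; rewrite lerBrDl -lerBrDr.
Qed.

(** The conjugate is the largest function that can serve as [rho] in a representation of [psi]. If
    [psi] is identically [-oo], the conjugate is [+oo] and each term of the infimum is [-oo]. *)
Lemma L_concave_biconjugate {R : realType} {d : nat}
    (L psi : 'rV[R]_d -> \bar R) (alpha : 'rV[R]_d) :
  (forall x, L x \is a fin_num) -> L_concave L psi ->
  ereal_inf [set L (alpha - theta)%R - conjugate L psi theta
            | theta in [set: 'rV[R]_d]] = psi alpha.
Proof.
move=> Lfin [psi_fin [rho rho_fin psiE]].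
have rho_le theta : rho theta <= conjugate L psi theta.
  apply: le_ereal_inf_tmp => _ [x _ <-].
  apply: leeB_swap => //; first by rewrite lt_eqF.
  by rewrite psiE; apply: ereal_inf_lbound; exists theta.
apply/eqP; rewrite eq_le; apply/andP; split.
  (* Replacing [rho] by the larger conjugate can only lower the infimum. *)
  rewrite [leRHS]psiE; apply: le_ereal_inf_tmp => _ [theta _ <-].
  apply: (@le_trans _ _ (L (alpha - theta)%R - conjugate L psi theta)).
    by apply: ereal_inf_lbound; exists theta.
  by rewrite leeB.
(* The reverse bound swaps the inequality given by the term at [alpha] in the infimum defining the
   conjugate. *)
apply: le_ereal_inf_tmp => _ [theta _ <-].
apply: leeB_swap => //; first by rewrite lt_eqF.
by apply: ereal_inf_lbound; exists alpha.
Qed.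

Theorem theorem5 (R : realType) (d : nat) (mu0 : probability (Rd R d) R)
    (cgf_fin : forall theta : 'rV[R]_d, cgf mu0 theta < +oo) :
  (forall h : 'rV[R]_d -> \bar R,
      measurable_fun [set: Rd R d] h ->
      (forall theta, h theta < +oo) ->
      (exists theta, h theta != -oo) ->
      let phi := variational h in
      exponentially_concave (Omega0 mu0) phi /\
      L_concave (cgf mu0)
        (fun alpha => phi (tilted cgf_fin alpha) + cgf mu0 alpha)) /\
  (forall psi : 'rV[R]_d -> \bar R,
      L_concave (cgf mu0) psi ->
      let phi := variational (conjugate (cgf mu0) psi) in
      exponentially_concave (Omega0 mu0) phi /\
      forall alpha, phi (tilted cgf_fin alpha) = psi alpha - cgf mu0 alpha).
Proof.
have fin x : cgf mu0 x \is a fin_num by rewrite fin_numElt cgf_gtNy cgf_fin.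
split=> [h _ h_fin [theta0 h0] phi|psi psi_conc phi].
  split; first exact: variational_exponentially_concave.
  have psiE alpha : phi (tilted cgf_fin alpha) + cgf mu0 alpha =
      ereal_inf [set cgf mu0 (alpha - theta)%R - h theta
                | theta in [set: 'rV[R]_d]].
    by rewrite /phi variational_tilted subeK.
  split; last by exists h.
  move=> alpha; rewrite psiE.
  (* The term at [theta0], where [h] is not [-oo], keeps the infimum below [+oo]. *)
  apply: (@le_lt_trans _ _ (cgf mu0 (alpha - theta0)%R - h theta0)).
    by apply: ereal_inf_lbound; exists theta0.
  by rewrite lte_add_pinfty// lteNl ltNye.
split; first exact: variational_exponentially_concave.
by move=> alpha; rewrite /phi variational_tilted L_concave_biconjugate.
Qed.
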